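(* Let $j,k\ge1$, let $p_1,\dots,p_j,q_1,\dots,q_k$ be distinct primes with $q_1<\cdots<q_k$, and let $G=S_{p_1}\times\cdots\times S_{p_j}\times\mathbb{Z}_s$ be a finite abelian group with $d(G)=2$, where $S_{p_i}$ is a non-cyclic abelian $p_i$-group of order $p_i^{u_i}$ for $1\le i\le j$, and $s=q_1^{t_1}\cdots q_k^{t_k}$ with all $t_i\ge1$. Set $\bar s=\prod_{i=1}^{j}p_i^{u_i}$, $\bar s_0=p_1\cdots p_j$, and $s_0=q_1\cdots q_k$. Let $X=\{1,\ldots,j\}$. The non-zero adjacency eigenvalues of $\Gamma(G)$, counted with multiplicity, are of the form $$(-1)^{|E^-|}\,\frac{s}{s_0}\sqrt{\varphi(s_0)}\;\varphi\!\left(\frac{\bar s}{\bar s_0}\right)\prod_{m\in E^+}p_m\prod_{\beta=1}^{k}u_{\beta,\ell_\beta},$$ parametrized over all partitions $(E^+,E^-)$ of $X$ and all choices $(\ell_1,\ldots,\ell_k)\in\{1,2\}^k$, where $$u_{\beta,1}=\frac{\sqrt{\varphi(q_{k+1-\beta})}+\sqrt{4+\varphi(q_{k+1-\beta})}}{2},\qquad u_{\beta,2}=\frac{\sqrt{\varphi(q_{k+1-\beta})}-\sqrt{4+\varphi(q_{k+1-\beta})}}{2}.$$ Each such eigenvalue (indexed by $(E^+,E^-)$ and $(\ell_1,\dots,\ell_k)$) has multiplicity $\prod_{i\in E^-}p_i$ (or $1$ if $E^-$ is empty). The eigenvalue $0$ has multiplicity $|G|-2^k\sigma(\bar s_0)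$.
   Context: The generating graph $\Gamma(G)$ of a group $G$ is the simple graph with vertex set $G$ in which two distinct vertices $x,y$ are adjacent if and only if $\langle x,y\rangle=G$. Adjacency eigenvalues are eigenvalues of its adjacency matrix. $d(G)$ is the minimum size of a generating set of $G$. $\varphi$ is the Euler totient function and $\sigma$ the sum-of-divisors function. In a partition $(E^+,E^-)$ of $X$ (i.e. $X=E^+\sqcup E^-$) one of the parts may be empty; empty products equal $1$. The statement describes the spectrum as a multiset: each index $((E^+,E^-),(\ell_1,\dots,\ell_k))$ contributes its value the stated number of times. *)

(* Defs.v *)
From HB Require Import structures.
From mathcomp Require Import all_boot all_order all_algebra all_fingroup.
From mathcomp Require Import all_solvable.

Set Implicit Arguments.
Unset Strict Implicit.
Unset Printing Implicit Defensive.

Import Order.TTheory GRing.Theory Num.Theory.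
Local Open Scope ring_scope.

Definition gen_graph (gT : finGroupType) (G : {group gT}) : rel gT :=
  fun x y => (x != y) && (<<[set x; y]>>%g == G :> {set gT}).

(* The vertices of the generating graph, i.e. the elements of G, are listed by
   enum_val : 'I_#|G| -> gT. *)
Definition gen_graph_mx (R : nzRingType) (gT : finGroupType) (G : {group gT}) :
    'M[R]_#|G| :=
  \matrix_(a < #|G|, b < #|G|)
    (gen_graph G (enum_val a : gT) (enum_val b : gT))%:R.

(* sp lists all the eigenvalues of A, each repeated according to its
   multiplicity; such an sp is unique up to permutation over a field. *)
Definition is_spectrum (R : comNzRingType) (n : nat) (A : 'M[R]_n)
    (sp : seq R) : Prop :=
  char_poly A = \prod_(x <- sp) ('X - x%:P).

Definition sigma (n : nat) : nat := (\sum_(d <- divisors n) d)%N.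

(* l = 0 gives the root with the plus sign, l = 1 the one with the minus. *)
Definition u_root (R : rcfType) (q : nat) (l : 'I_2) : R :=
  (Num.sqrt (totient q)%:R + (-1) ^+ l * Num.sqrt (4 + (totient q)%:R)) / 2.

(* A partition (E+, E-) of 'I_j is encoded by E+ = E alone, with E- = ~: E.
   With indices starting at 0, rev_ord b plays the role of k + 1 - beta. *)
Definition eig_val (R : rcfType) (j k : nat) (p : 'I_j -> nat)
    (q : 'I_k -> nat) (s s0 sbar sbar0 : nat)
    (E : {set 'I_j}) (l : {ffun 'I_k -> 'I_2}) : R :=
  (-1) ^+ #|~: E| * (s%:R / s0%:R) * Num.sqrt (totient s0)%:R
  * (totient (sbar %/ sbar0))%:R
  * (\prod_(m in E) (p m)%:R) * \prod_(b < k) u_root R (q (rev_ord b)) (l b).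

Definition eig_mult (j : nat) (p : 'I_j -> nat) (E : {set 'I_j}) : nat :=
  (\prod_(i in ~: E) p i)%N.

(* Main.v *)
(* Generation of an abelian group is tested on its Sylow subgroups, so the
   adjacency matrix of the generating graph is a tensor product of the matrices
   of the relations <<x, y>> = H, one for each Sylow subgroup H. If H is a
   non-cyclic p-group of rank 2 this relation is complete multipartite on the
   complement of the Frattini subgroup, the parts being the p + 1 maximal
   subgroups minus 'Phi(H); its non-zero eigenvalues are those of J - I on
   p + 1 points, scaled by the size of a part. If H is cyclic the relation says
   that x or y is a generator, hence has rank 2 with two classes. Writing each
   local matrix as F * diag(lam) * E with E * F = 1 makes the tensor product
   immediate, and Sylvester's determinant identity gives the characteristic
   polynomial of the product. *)
Require Import Defs.
From HB Require Import structures.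
From mathcomp Require Import all_boot all_order all_algebra all_fingroup.
From mathcomp Require Import all_solvable.
From mathcomp Require Import ring.

Set Implicit Arguments.
Unset Strict Implicit.
Unset Printing Implicit Defensive.

Import Order.TTheory GRing.Theory Num.Theory.
Local Open Scope ring_scope.

(** * Characteristic polynomials *)

(* Both sides are determinants of products of [[X, A], [B, 1]] with a
   unipotent or triangular block matrix. *)
Lemma char_poly_mulC (R : comNzRingType) m n (A : 'M[R]_(m, n))
    (B : 'M[R]_(n, m)) :
  'X^n * char_poly (A *m B) = 'X^m * char_poly (B *m A).
Proof.
pose A' := map_mx (@polyC R) A; pose B' := map_mx (@polyC R) B.
pose M := block_mx ('X%:M : 'M_m) A' B' (1%:M : 'M_n).
have <- : \det M = char_poly (A *m B).
  pose L := block_mx (1%:M : 'M_m) 0 (- B') (1%:M : 'M_n).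
  have detL : \det L = 1 by rewrite det_lblock !det1 mulr1.
  rewrite -[LHS]mulr1 -detL -det_mulmx mulmx_block.
  rewrite !(mulmx0, mulmx1, mul1mx, add0r, mulmxN) subrr.
  by rewrite det_ublock det1 mulr1 /char_poly /char_poly_mx map_mxM.
pose U := block_mx (1%:M : 'M_m) (- A') 0 ('X%:M : 'M_n).
have detU : \det U = 'X^n by rewrite det_ublock det1 mul1r det_scalar.
rewrite mulrC -detU -det_mulmx mulmx_block.
rewrite !(mulmx0, mulmx1, mul1mx, addr0, mulmxN) mul_mx_scalar mul_scalar_mx.
rewrite addNr det_lblock det_scalar /char_poly /char_poly_mx map_mxM.
by rewrite addrC.
Qed.

(** The hypotheses say [A = F * diag(lam) * E] with [E * F = 1]; moving [F] to the right end leaves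
    [diag(lam)], at the price of a power of ['X]. *)
Lemma char_poly_biorthogonal (R : fieldType) N (I : finType) (P : pred I)
    (lam : I -> R) (f : 'I_N -> I -> R) (e : I -> 'I_N -> R) (A : 'M[R]_N) :
    (forall a b, P a -> P b -> \sum_x e a x * f x b = (a == b)%:R) ->
    (forall x y, A x y = \sum_(a | P a) f x a * lam a * e a y) ->
  (#|P| <= N)%N /\
  char_poly A = 'X^(N - #|P|) * \prod_(a | P a) ('X - (lam a)%:P).
Proof.
move=> orth Aeq.
pose F : 'M[R]_(N, #|P|) := \matrix_(x, a) f x (enum_val a).
pose E : 'M[R]_(#|P|, N) := \matrix_(a, x) e (enum_val a) x.
pose L : 'rV[R]_#|P| := \row_a lam (enum_val a).
have EF : E *m F = 1%:M.
  apply/matrixP=> a b; rewrite !mxE.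
  under eq_bigr => x _ do rewrite !mxE.
  rewrite orth; last by exact: (enum_valP b).
    by rewrite (inj_eq enum_val_inj).
  exact: (enum_valP a).
have AE : A = F *m (diag_mx L *m E).
  apply/matrixP=> x y; rewrite mul_diag_mx !mxE Aeq.
  rewrite [LHS](eq_bigl (fun a => a \in P)) // big_enum_val /=.
  by apply: eq_bigr => a _; rewrite !mxE mulrA.
(* The identity of size [#|P|] factors through dimension [N], which bounds its rank. *)
have leN : (#|P| <= N)%N.
  by rewrite -(mxrank1 R #|P|) -EF (leq_trans (mxrankM_maxr _ _)) ?rank_leq_row.
split=> //.
have X0 : 'X^#|P| != 0 :> {poly R} by rewrite expf_neq0 ?polyX_eq0.
apply: (mulfI X0); rewrite {1}AE char_poly_mulC -mulmxA EF mulmx1.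
rewrite char_poly_trig ?diag_mx_is_trig // mulrA -exprD subnKC //.
congr (_ * _); rewrite [RHS](eq_bigl (fun a => a \in P)) // [RHS]big_enum_val /=.
by apply: eq_bigr => a _; rewrite !mxE eqxx mulr1n.
Qed.

(** * Local spectral decompositions *)

(* The columns f _ a span the image of the matrix of the relation
   <<[set x; y]>> = H on H, the rows e a _ are the dual basis, and lam a are
   the eigenvalues. *)
Definition spectral_frame (R : nzRingType) (gT : finGroupType) (H : {set gT})
    (m : nat) (lam : nat -> R) (e : nat -> gT -> R) (f : gT -> nat -> R) :=
  (forall a b, (a < m)%N -> (b < m)%N ->
     \sum_(x in H) e a x * f x b = (a == b)%:R) /\
  (forall x y, x \in H -> y \in H ->
     (<<[set x; y]>>%g == H)%:R = \sum_(a < m) f x a * lam a * e a y).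

(** Whether [x] and [y] generate [H] depends only on their classes under [kappa], so sums over [H]
    become sums over classes weighted by [w], and a decomposition of the small matrix [K] pulls
    back. *)
Lemma spectral_frame_blowup (R : nzRingType) (gT : finGroupType)
    (H : {set gT}) n m (kappa : gT -> nat) (w : nat -> nat) (K : rel nat)
    (lam : nat -> R) (e f : nat -> nat -> R) :
    (forall x, x \in H -> (kappa x < n)%N) ->
    (forall c, (c < n)%N -> #|[set x in H | kappa x == c]| = w c) ->
    (forall x y, x \in H -> y \in H ->
       (<<[set x; y]>>%g == H) = K (kappa x) (kappa y)) ->
    (forall a b, (a < m)%N -> (b < m)%N ->
       \sum_(c < n) (e a c * f c b) *+ w c = (a == b)%:R) ->
    (forall c d, (c < n)%N -> (d < n)%N ->
       (K c d)%:R = \sum_(a < m) f c a * lam a * e a d) ->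
  spectral_frame H m lam (fun a x => e a (kappa x)) (fun x a => f (kappa x) a).
Proof.
move=> ltk cardk genk orth rec; split=> [a b ltam ltbm | x y Hx Hy]; last first.
  by rewrite genk // rec ?ltk.
(* [inord] below needs a type ['I_n.+1]; without classes [H] has no elements and both sums
   vanish. *)
rewrite -orth //; case: n => [|n] in ltk cardk orth rec *.
  by rewrite big_ord0 big1 // => x /ltk.
rewrite (partition_big (fun x => inord (kappa x) : 'I_n.+1) predT) //=.
apply: eq_bigr => c _; rewrite -cardk // -sumr_const.
apply: eq_big => [x | x /andP[Hx /eqP <-]]; last by rewrite inordK ?ltk.
rewrite inE; case Hx: (x \in H) => //=.
by rewrite -val_eqE /= inordK ?ltk.
Qed.

Lemma sum_delta (R : nzRingType) n (g : nat -> R) b : (b < n)%N ->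
  \sum_(c < n) (c == b :> nat)%:R * g c = g b.
Proof.
move=> ltbn; rewrite (bigD1 (Ordinal ltbn)) //= eqxx mul1r big1 ?addr0 // => c.
by rewrite -val_eqE /= => /negPf->; rewrite mul0r.
Qed.

(* [J - I] on [p + 1] points, each blown up to [c] copies, together with an
   isolated class of index [p.+1]. *)
Lemma multipartite_frame (R : numFieldType) p c (w : nat -> nat) :
    (0 < c)%N -> (forall d, (d < p.+1)%N -> w d = c) ->
  exists e f : nat -> nat -> R,
  (forall a b, (a < p.+1)%N -> (b < p.+1)%N ->
     \sum_(d < p.+2) (e a d * f d b) *+ w d = (a == b)%:R) /\
  (forall d d', (d < p.+2)%N -> (d' < p.+2)%N ->
     [&& d < p.+1, d' < p.+1 & d != d']%N%:R
     = \sum_(a < p.+1) f d a * (if a == 0 :> nat then c%:R * p%:R else - c%:R)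
                       * e a d').
Proof.
move=> c_gt0 wc; pose n : R := p.+1%:R.
have n0 : n != 0 by rewrite pnatr_eq0.
have c0 : c%:R != 0 :> R by rewrite pnatr_eq0 -lt0n.
have sum1 a : (a < p.+1)%N -> \sum_(d < p.+1) (d == a :> nat)%:R = 1 :> R.
  move=> lta; rewrite -[RHS](sum_delta (fun=> 1) lta).
  by apply: eq_bigr => d _; rewrite mulr1.
have sumc (z : R) : \sum_(d < p.+1) z = n * z.
  by rewrite sumr_const card_ord -mulr_natl.
(* The constant vector and the differences [delta_a - delta_0] are eigenvectors of [J - I] for [p]
   and [-1]; [e0] is their dual basis. *)
pose f0 (d a : nat) : R := if a == 0%N then 1 else (d == a)%:R - (d == 0%N)%:R.
pose e0 (a d : nat) : R := if a == 0%N then n^-1 else (d == a)%:R - n^-1.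
(* The Boolean factor removes the isolated class; dividing by [c] offsets the weight of each
   part. *)
exists (fun a d => (d < p.+1)%N%:R * (e0 a d / c%:R)),
  (fun d a => (d < p.+1)%N%:R * f0 d a).
split=> [a b lta ltb | d d' ltd ltd'].
  rewrite big_ord_recr /= ltnn !mul0r mul0rn addr0.
  transitivity (\sum_(d < p.+1) e0 a d * f0 d b).
    apply: eq_bigr => d _; rewrite wc // ltn_ord !mul1r -mulr_natr; field.
    exact: c0.
  rewrite /e0 /f0; have [a_0 | a0] := eqVneq a 0%N; have [b_0 | b0] := eqVneq b 0%N;
    rewrite ?a_0 ?b_0.
  - by rewrite sumc mulr1 mulfV ?eqxx.
  - by rewrite -mulr_sumr sumrB !sum1 // subrr mulr0 eq_sym (negPf b0).
  - under eq_bigr do rewrite mulr1.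
    by rewrite sumrB sum1 // sumc mulfV // subrr (negPf a0).
  under eq_bigr do rewrite mulrBl.
  rewrite sumrB -mulr_sumr sumrB !sum1 // subrr mulr0 subr0.
  by rewrite (sum_delta (fun d => (d == b)%:R - (d == 0%N)%:R)) // (negPf a0) subr0.
case: (ltnP d p.+1) => [{}ltd | _] /=; last first.
  by rewrite big1 // => a _; rewrite !mul0r.
case: (ltnP d' p.+1) => [{}ltd' | _] /=; last first.
  by rewrite big1 // => a _; rewrite mul0r mulr0.
transitivity (\sum_(a < p.+1)
    f0 d a * (if a == 0 :> nat then p%:R else - 1) * e0 a d'); last first.
  apply: eq_bigr => a _; rewrite !mul1r; case: ifP => _; field; exact: c0.
(* Up to sign, [h a] is the rank-one term of index [a > 0]. Its formula vanishes at [a = 0], so the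
   sum may run over all indices, where the delta sums apply. *)
pose h (a : nat) : R := ((d == a)%:R - (d == 0%N)%:R) * ((d' == a)%:R - n^-1).

have sumh : \sum_(a < p.+1) h a = (d == d')%:R - n^-1.
  have hE a : h a = (a == d)%:R * ((d' == a)%:R - n^-1)
                   - (d == 0%N)%:R * ((a == d')%:R - n^-1).
    by rewrite /h mulrBl ![_ == a]eq_sym.
  under eq_bigr do rewrite hE.
  rewrite sumrB (sum_delta (fun a => (d' == a)%:R - n^-1)) // -mulr_sumr.
  by rewrite sumrB sum1 // sumc mulfV // subrr mulr0 subr0 eq_sym.
have -> : (d != d')%:R = p%:R / n - \sum_(a < p) h a.+1.
  have h0 : h 0%N = 0.
    by rewrite /h; case: d {ltd sumh h} => [|d]; rewrite subrr mul0r.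
  move: sumh; rewrite big_ord_recl /= h0 add0r.
  under eq_bigr do rewrite /bump /= add1n.
  move=> ->; rewrite opprB addrA.
  have -> : p%:R / n + n^-1 = 1.
    by rewrite -{2}[n^-1]mul1r -mulrDl natr1 mulfV.
  by case: (d == d'); rewrite ?subrr ?subr0.
rewrite big_ord_recl /= /f0 /e0 /= mul1r; congr (_ + _).
rewrite -sumrN; apply: eq_bigr => a _; rewrite /h /bump /= add1n.
by rewrite mulrN1 mulNr.
Qed.

(* The two classes have weights [c] and [c * phi]; [mu0] and [mu1] are the
   roots of [X^2 - phi X - phi]. *)
Lemma cyclic_frame (R : numFieldType) c phi (mu : nat -> R) (w : nat -> nat) :
    (0 < c)%N -> (0 < phi)%N -> w 0%N = c -> w 1%N = (c * phi)%N ->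
    mu 0%N + mu 1%N = phi%:R -> mu 0%N * mu 1%N = - phi%:R ->
    mu 0%N != mu 1%N ->
  exists e f : nat -> nat -> R,
  (forall a b, (a < 2)%N -> (b < 2)%N ->
     \sum_(d < 2) (e a d * f d b) *+ w d = (a == b)%:R) /\
  (forall d d', (d < 2)%N -> (d' < 2)%N ->
     ((d == 1) || (d' == 1))%N%:R
     = \sum_(a < 2) f d a * (c%:R * mu a) * e a d').
Proof.
move=> c_gt0 phi_gt0 w0 w1 muD muM mu_neq.
have c0 : c%:R != 0 :> R by rewrite pnatr_eq0 -lt0n.
have phi0 : phi%:R != 0 :> R by rewrite pnatr_eq0 -lt0n.
have delta0 : mu 0%N - mu 1%N != 0 by rewrite subr_eq0.
have mu00 : mu 0%N != 0.
  by apply: contraNneq phi0 => m0; rewrite -oppr_eq0 -muM m0 mul0r.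
have phiM : phi%:R = - (mu 0%N * mu 1%N) by rewrite muM opprK.
have mu10 : mu 1%N != 0.
  by apply: contraNneq phi0 => m0; rewrite -oppr_eq0 -muM m0 mulr0.
(* For the matrix [[[0, 1], [1, 1]]] with weights [c] and [c * phi], the vector [(phi, mu a)] is an
   eigenvector for [c * mu a]. By symmetry [e] is [f] divided by its weighted norm
   [c * phi * (phi + mu a ^+ 2)], which is [(-1) ^+ a * c * phi * mu a * (mu 0 - mu 1)] because
   [phi = - mu 0 * mu 1]. *)
pose f (d a : nat) : R := if d == 0%N then phi%:R else mu a.
pose e (a d : nat) : R :=
  (-1) ^+ a * f d a / (phi%:R * (mu 0%N - mu 1%N) * c%:R * mu a).
exists e, f; split.
  move=> a b; case: a => [|[|a]]; case: b => [|[|b]] // _ _;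
    rewrite big_ord_recl big_ord1 /=;
    rewrite w0 w1 /e /f /= -[_ *+ c]mulr_natr -[_ *+ (c * phi)]mulr_natr natrM;
    rewrite phiM; field; rewrite ?mu00 ?mu10 ?c0 ?oppr_eq0 ?delta0 //.
move=> d d'; case: d => [|[|d]]; case: d' => [|[|d']] // _ _;
  rewrite big_ord_recl big_ord1 /= /e /f /= -?muD; field;
  by rewrite mu10 c0 delta0 mu00 muD phi0.
Qed.

(** * Abelian groups of rank two *)

Section RankTwo.
Local Open Scope nat_scope.
Local Open Scope group_scope.
Variables (gT : finGroupType) (H : {group gT}) (p : nat).
Hypotheses (p_pr : prime p) (pH : p.-group H) (cHH : abelian H).
Hypotheses (ncH : ~~ cyclic H) (rH : 'm(H) <= 2).

Let Phi := 'Phi(H)%G.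
Let nPhi : H \subset 'N(Phi).
Proof. exact: normal_norm (Phi_normal H). Qed.
Let abH : p.-abelem (H / Phi).
Proof. exact: Phi_quotient_abelem. Qed.

Let p_gt0 : 0 < p. Proof. exact: prime_gt0. Qed.
Let p_gt1 : 1 < p. Proof. exact: prime_gt1. Qed.
Let Phi_gt0 : 0 < #|Phi|. Proof. exact: cardG_gt0. Qed.

(** The Frattini quotient is elementary abelian; its rank is at most ['m(H)], and rank below two
    would make [H] cyclic. *)
Lemma rank2_card_Phi : #|H| = (p ^ 2 * #|Phi|)%N.
Proof.
have lg2 : logn p #|H / Phi| = 2.
  apply/eqP; rewrite eqn_leq; apply/andP; split.
    rewrite -(rank_abelem abH) -grank_abelian ?quotient_abelian //.
    exact: leq_trans (quotient_grank nPhi) rH.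
  rewrite ltnNge -(abelem_cyclic abH).
  by apply: contra ncH; apply: Phi_quotient_cyclic.
rewrite -(Lagrange (Phi_sub H)) mulnC; congr (_ * _)%N.
rewrite -card_quotient // (card_pgroup (quotient_pgroup Phi pH)).
by rewrite lg2.
Qed.

(** For [x] in [H] outside [Phi] this is the unique maximal subgroup of [H] containing [x]. *)
Definition rank2_class (x : gT) : {set gT} := <[x]> <*> Phi.

Let classG x : rank2_class x = (<[x]> <*> Phi)%G. Proof. by []. Qed.

Lemma card_rank2_class x : x \in H :\: Phi -> #|rank2_class x| = (p * #|Phi|)%N.
Proof.
case/setDP=> Hx nPx; rewrite -(LagrangeI (<[x]> <*> Phi) Phi) mulnC.
rewrite (setIidPr (joing_subr _ _)) -card_quotient; last first.
  by rewrite join_subG normG cycle_subG (subsetP nPhi).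
rewrite quotientYidr ?cycle_subG ?(subsetP nPhi) //.
rewrite quotient_cycle ?(subsetP nPhi) // -orderE.
rewrite (abelem_order_p abH) ?mem_quotient //.
by apply: contra nPx => /eqP/coset_idr; apply; rewrite (subsetP nPhi).
Qed.

Lemma rank2_class_id x : x \in rank2_class x.
Proof. by rewrite (subsetP (joing_subl _ _)) ?cycle_id. Qed.

Lemma rank2_class_sub x : x \in H -> rank2_class x \subset H.
Proof. by move=> Hx; rewrite join_subG cycle_subG Hx Phi_sub. Qed.

Lemma rank2_class_eq x y : x \in H :\: Phi -> y \in H :\: Phi ->
  (rank2_class y == rank2_class x) = (y \in rank2_class x).
Proof.
move=> Dx Dy; apply/eqP/idP => [<- | Mxy]; first exact: rank2_class_id.
apply/eqP; rewrite eqEcard !card_rank2_class // leqnn andbT.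
by rewrite join_subG cycle_subG joing_subr Mxy.
Qed.

(** If one of [x], [y] lay in [Phi], the other would generate [H] alone, against non-cyclicity; two
    elements of one class stay in a subgroup of index [p]. Otherwise [y] lies outside a subgroup of
    prime index containing [x] and [Phi]. *)
Lemma rank2_gen x y : x \in H -> y \in H ->
  (<<[set x; y]>> == H) =
  [&& x \notin Phi, y \notin Phi & rank2_class x != rank2_class y].
Proof.
have Phi_gen1 u v : <<[set u; v]>> = H -> u \notin Phi.
  move=> defH; apply: contra ncH => Pu.
  apply/cyclicP; exists v; rewrite /cycle; symmetry.
  apply: Phi_nongen; apply/eqP; rewrite eqEsubset join_subG Phi_sub /=.
  rewrite -{1 2}defH sub1set (subsetP (subset_gen _)) ?set22 //= gen_subG.
  apply/subsetP=> z /set2P[->|->].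
    exact: (subsetP (joing_subl _ _)).
  by rewrite (subsetP (joing_subr _ _)) ?set11.
move=> Hx Hy; apply/eqP/and3P=> [defH | [nPx nPy neM]].
  split; first exact: Phi_gen1 defH.
    by apply: (Phi_gen1 y x); rewrite setUC.
  have Dx : x \in H :\: Phi by rewrite inE (Phi_gen1 _ _ defH).
  apply/eqP=> eqM; have /subset_leq_card : H \subset rank2_class x.
    rewrite -defH classG gen_subG subUset !sub1set rank2_class_id /=.
    by rewrite -classG eqM rank2_class_id.
  rewrite card_rank2_class // rank2_card_Phi leq_pmul2r // -{2}(expn1 p).
  by rewrite leq_exp2l.
have [Dx Dy] : x \in H :\: Phi /\ y \in H :\: Phi by rewrite !inE nPx nPy.
pose Mx := (<[x]> <*> Phi)%G; pose L := (Mx <*> <[y]>)%G.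
have sLH : L \subset H by rewrite !join_subG !cycle_subG Hx Hy Phi_sub.
have sML : Mx \subset L by apply: joing_subl.
have iM : #|H : Mx| = p.
  apply/eqP; rewrite -(eqn_pmul2l (cardG_gt0 Mx)) Lagrange ?rank2_class_sub //.
  by rewrite [#|Mx|](card_rank2_class Dx) rank2_card_Phi mulnAC mulnn.
have := Lagrange_index sLH sML; rewrite iM => ip.
(* [L] lies between [Mx], of prime index, and [H], so it is one of the two; [L = Mx] would put [y]
   in the class of [x]. *)
have : #|H : L| %| p by rewrite -ip dvdn_mulr.
case/primeP: p_pr => _ /[apply] /orP[] /eqP iL; last first.
  have /eqP : #|L : Mx| = 1%N.
    by move/eqP: ip; rewrite iL -{2}(muln1 p) eqn_pmul2l // => /eqP.
  rewrite indexg_eq1 => sLM; case/eqP: neM; apply/eqP.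
  rewrite eq_sym rank2_class_eq // (subsetP sLM) //.
  by rewrite (subsetP (joing_subr _ _)) ?cycle_id.
have sHL : H \subset L by rewrite -indexg_eq1 iL.
apply: Phi_nongen; apply/eqP; rewrite eqEsubset join_subG Phi_sub /=.
rewrite subUset !sub1set Hx Hy /= (subset_trans sHL) //.
rewrite !join_subG !cycle_subG joing_subl andbT.
by rewrite !(subsetP (joing_subr _ _)) ?inE ?eqxx ?orbT.
Qed.

Let classes := rank2_class @: (H :\: Phi).

Lemma card_rank2_class_fiber x : x \in H :\: Phi ->
  #|[set y in H :\: Phi | rank2_class y == rank2_class x]| = (p.-1 * #|Phi|)%N.
Proof.
move=> Dx; rewrite -subn1 mulnBl mul1n -(card_rank2_class Dx).
have <- : rank2_class x :\: Phi
          = [set y in H :\: Phi | rank2_class y == rank2_class x].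
  apply/setP=> y; rewrite [RHS]inE; case Dy: (y \in H :\: Phi) => /=.
    by rewrite rank2_class_eq // inE (setDP Dy).2.
  apply: contraFF Dy => /setDP[My nPy]; rewrite inE nPy.
  by apply: (subsetP (rank2_class_sub _)) My; case/setDP: Dx.
by rewrite cardsD (setIidPr _) // joing_subr.
Qed.

(** [H :\: Phi] has [(p ^ 2 - 1) * #|Phi|] elements, and each class contains [(p - 1) * #|Phi|] of
    them. *)
Lemma card_rank2_classes : #|classes| = p.+1.
Proof.
have p1 : 0 < p.-1 by rewrite -subn1 subn_gt0.
have cardD : #|H :\: Phi| = (#|classes| * (p.-1 * #|Phi|))%N.
  rewrite -sum1_card (partition_big_imset rank2_class) /= -sum_nat_const.
  apply: eq_bigr => M /imsetP[x Dx ->].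
  by rewrite sum1dep_card card_rank2_class_fiber.
apply/eqP; rewrite -(eqn_pmul2r p1) -(eqn_pmul2r Phi_gt0) -mulnA -cardD.
rewrite cardsD (setIidPr (Phi_sub H)) rank2_card_Phi -{2}[#|Phi|]mul1n -mulnBl.
rewrite -{2}(exp1n 2) subn_sqr subn1 addn1; apply/eqP; congr (_ * _)%N.
exact: mulnC.
Qed.

(** Maximal subgroups are numbered from [0] to [p]; the value [p.+1] on [Phi] is the isolated class
    of [multipartite_frame]. *)
Definition rank2_label (x : gT) :=
  if x \in Phi then p.+1 else index (rank2_class x) (enum classes).

Lemma rank2_label_lt x : x \in H :\: Phi -> rank2_label x < p.+1.
Proof.
move=> Dx; rewrite /rank2_label; case/setDP: (Dx) => _ /negPf->.
by rewrite -card_rank2_classes cardE index_mem mem_enum imset_f.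
Qed.

Lemma rank2_label_eq x y : x \in H :\: Phi -> y \in H :\: Phi ->
  (rank2_label x == rank2_label y) = (rank2_class x == rank2_class y).
Proof.
move=> Dx Dy; rewrite /rank2_label.
case/setDP: (Dx) => _ /negPf->; case/setDP: (Dy) => _ /negPf->.
apply/eqP/eqP=> [eqi | -> //].
rewrite -[LHS](nth_index set0 (_ : _ \in enum classes)) ?mem_enum ?imset_f // eqi.
by rewrite nth_index // mem_enum imset_f.
Qed.

Lemma card_rank2_label m : m < p.+1 ->
  #|[set x in H | rank2_label x == m]| = (p.-1 * #|Phi|)%N.
Proof.
move=> ltm; pose M := nth set0 (enum classes) m.
have szc : size (enum classes) = p.+1 by rewrite -cardE card_rank2_classes.
have : M \in classes by rewrite -mem_enum mem_nth ?szc.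
case/imsetP=> x Dx defM; rewrite -(card_rank2_class_fiber Dx).
have lx : rank2_label x = m.
  rewrite /rank2_label; case/setDP: (Dx) => _ /negPf->.
  by rewrite -defM index_uniq ?enum_uniq ?szc.
apply: eq_card => y; rewrite !inE -lx.
case Py: (y \in Phi) => /=.
  by rewrite lx /rank2_label Py (gtn_eqF ltm) andbF.
case Hy: (y \in H) => //=.
by rewrite rank2_label_eq // inE Hy Py.
Qed.

(** As [#|H| / p = p * #|Phi|] is a power of [p], its totient [c] is the number [(p - 1) * #|Phi|]
    of elements in a part. *)
Lemma rank2_spectral_frame (R : numFieldType) :
  exists (e : nat -> gT -> R) (f : gT -> nat -> R),
    let c := (totient (#|H| %/ p))%:R%R in
    spectral_frame H p.+1 (fun a => if a == 0%N then c * p%:R else - c)%R e f.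
Proof.
have [v cPhi] := p_natP (pgroupS (Phi_sub H) pH : p.-nat #|Phi|).
have -> : totient (#|H| %/ p) = (p.-1 * #|Phi|)%N.
  rewrite rank2_card_Phi expnS expn1 -mulnA mulKn //.
  by rewrite cPhi -expnS totient_pfactor.
pose c := (p.-1 * #|Phi|)%N.
have c_gt0 : 0 < c by rewrite muln_gt0 Phi_gt0 -subn1 subn_gt0 p_gt1.
have [e [f [orth rec]]] := multipartite_frame R c_gt0 card_rank2_label.
exists (fun a x => e a (rank2_label x)), (fun x a => f (rank2_label x) a).
apply: (spectral_frame_blowup _ _ _ orth rec) => [x Hx | // | x y Hx Hy].
  case Px: (x \in Phi); first by rewrite /rank2_label Px.
  by rewrite ltnW // ltnS rank2_label_lt // inE Px.
rewrite rank2_gen //.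
have lt_lab z : z \in H -> (rank2_label z < p.+1) = (z \notin Phi).
  move=> Hz; case Pz: (z \in Phi); first by rewrite /rank2_label Pz ltnn.
  by rewrite rank2_label_lt // inE Pz.
rewrite !lt_lab //; case Px: (x \in Phi); case Py: (y \in Phi) => //=.
by rewrite rank2_label_eq // inE ?Px ?Py.
Qed.

End RankTwo.

(** * Cyclic groups and the Sylow decomposition *)

(** These are the roots of [X^2 - phi X - phi] with [phi = totient q]: the share of [q] in
    [sqrt (totient s0)] is absorbed into [u_root]. *)
Definition u_scaled (R : rcfType) (q a : nat) : R :=
  Num.sqrt (totient q)%:R * u_root R q (inord a).

Lemma u_scaled_roots (R : rcfType) q : prime q ->
  let mu := u_scaled R q in
  [/\ mu 0%N + mu 1%N = (totient q)%:R, mu 0%N * mu 1%N = - (totient q)%:R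
    & mu 0%N != mu 1%N].
Proof.
move=> q_pr mu; have phi_gt0 : 0 < (totient q)%:R :> R.
  by rewrite ltr0n totient_gt0 prime_gt0.
rewrite /mu /u_scaled /u_root !inordK // expr0 expr1 mul1r mulN1r.
have sqr_a := sqr_sqrtr (ltW phi_gt0).
have sqr_b : Num.sqrt (4 + (totient q)%:R) ^+ 2 = 4 + (totient q)%:R :> R.
  by rewrite sqr_sqrtr // addr_ge0 ?ltW.
have a_gt0 : 0 < Num.sqrt (totient q)%:R :> R by rewrite sqrtr_gt0.
have b_gt0 : 0 < Num.sqrt (4 + (totient q)%:R) :> R by rewrite sqrtr_gt0 addr_gt0.
move: sqr_a sqr_b a_gt0 b_gt0.
set a := Num.sqrt (totient q)%:R; set b := Num.sqrt (4 + _).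
move=> sqr_a sqr_b a_gt0 b_gt0; split.
- by rewrite -sqr_a; field.
- transitivity (a ^+ 2 * (a ^+ 2 - b ^+ 2) / 4); first by field.
  by rewrite sqr_b sqr_a; field.
rewrite -subr_eq0 (_ : _ - _ = a * b); last by field.
by rewrite mulf_neq0 ?gt_eqF.
Qed.

(** The subgroups of a cyclic [q]-group form a chain, so [<<[set x; y]>>] is the larger of [<[x]>]
    and [<[y]>]. There are [c = q ^ t.-1] non-generators and [totient (q ^ t) = c * totient q]
    generators. *)
Lemma cyclic_spectral_frame (R : rcfType) (gT : finGroupType) (H : {group gT})
    (q t : nat) :
    prime q -> cyclic H -> (0 < t)%N -> #|H| = (q ^ t)%N ->
  exists (e : nat -> gT -> R) (f : gT -> nat -> R),
    spectral_frame H 2 (fun a => (#|H| %/ q)%:R * u_scaled R q a) e f.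
Proof.
move=> q_pr cycH t_gt0 cardH.
have c_eq : (#|H| %/ q = q ^ t.-1)%N.
  by rewrite cardH -{1}(prednK t_gt0) expnS mulKn ?prime_gt0.
have phi_eq : totient q = q.-1 by rewrite -{1}(expn1 q) totient_pfactor // muln1.
have cgen : #|[set x in H | <[x]>%g == H]| = (#|H| %/ q * totient q)%N.
  have -> : (#|H| %/ q * totient q)%N = totient #|H|.
    by rewrite c_eq cardH totient_pfactor // phi_eq mulnC.
  case/cyclicP: cycH => a defH; rewrite defH -orderE totient_gen.
  apply: eq_card => x; rewrite !inE /generator eq_sym andbC.
  by case: eqP => // ->; rewrite cycle_id.
pose kappa x := nat_of_bool (<[x]>%g == H).
pose w d := #|[set x in H | kappa x == d]|.
have w1 : w 1%N = (#|H| %/ q * totient q)%N.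
  by rewrite -cgen; apply: eq_card => x; rewrite !inE eqb1.
have w0 : w 0%N = (#|H| %/ q)%N.
  have eqH : #|H| = (w 1 + w 0)%N.
    rewrite -(cardsID [set x in H | <[x]>%g == H] H); congr (_ + _)%N.
      by apply: eq_card => x; rewrite !inE eqb1 andbA andbb.
    by apply: eq_card => x; rewrite !inE eqb0; case: (x \in H); rewrite ?andbT ?andbF.
  apply/eqP; rewrite -(eqn_add2l (w 1%N)) -eqH w1 -mulnSr c_eq cardH phi_eq.
  by rewrite prednK ?prime_gt0 // -expnSr prednK.
have [muD muM mu_neq] := u_scaled_roots R q_pr.
have c_gt0 : (0 < #|H| %/ q)%N by rewrite c_eq expn_gt0 prime_gt0.
have phi_gt0 : (0 < totient q)%N by rewrite totient_gt0 prime_gt0.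
have [e [f [orth rec]]] := cyclic_frame c_gt0 phi_gt0 w0 w1 muD muM mu_neq.
exists (fun a x => e a (kappa x)), (fun x a => f (kappa x) a).
apply: (spectral_frame_blowup _ _ _ orth rec) => [x Hx | // | x y Hx Hy].
  by rewrite /kappa; case: eqP.
rewrite /kappa !eqb1; apply/eqP/orP=> [defH | gen].
  have [sxH syH] : <[x]>%g \subset H /\ <[y]>%g \subset H by rewrite !cycle_subG.
  have sub_gen u v : <<[set u; v]>>%g = H -> (u \in <[v]>)%g -> <[v]>%g == H.
    move=> <- uv; rewrite eqEsubset genS ?subsetUr //= gen_subG subUset !sub1set.
    by rewrite uv cycle_id.
  have [i _ cx] : exists2 i, (i <= t)%N & #|<[x]>%g| = (q ^ i)%N.
    by apply/dvdn_pfactor; rewrite // -cardH cardSg.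
  have [j _ cy] : exists2 i, (i <= t)%N & #|<[y]>%g| = (q ^ i)%N.
    by apply/dvdn_pfactor; rewrite // -cardH cardSg.
  have [leij | leji] := leqP i j.
    right; apply: sub_gen defH _.
    by rewrite -cycle_subG -(cardSg_cyclic cycH) // cx cy dvdn_exp2l.
  left; apply: (sub_gen y x); first by rewrite setUC.
  by rewrite -cycle_subG -(cardSg_cyclic cycH) // cx cy dvdn_exp2l // ltnW.
apply/eqP; rewrite eqEsubset gen_subG subUset !sub1set Hx Hy /=.
by case: gen => /eqP <-; rewrite genS // sub1set ?set21 ?set22.
Qed.

(** * Primary components in a finite abelian group *)

Section Primary.
Variables (gT : finGroupType) (G : {group gT}) (I : finType).
Variables (r : I -> nat) (H : I -> {group gT}).
Hypotheses (cGG : abelian G) (r_inj : injective r).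
Hypothesis r_pi : forall p, prime p -> (p %| #|G|)%N -> exists i, p = r i.
Hypothesis sylH : forall i, ((r i).-Sylow(G) (H i))%g%g.
Local Open Scope group_scope.

Let sHG i : H i \subset G. Proof. exact: pHall_sub (sylH i). Qed.

Lemma mem_primary i x : x \in G -> (x \in H i) = (r i).-elt x.
Proof.
by apply: mem_normal_Hall (sylH i) _; rewrite -sub_abelian_normal.
Qed.

Lemma constt_primary i x : x \in G -> x.`_(r i) \in H i.
Proof. by move=> Gx; rewrite mem_primary ?groupX // p_elt_constt. Qed.

Lemma consttM_abelian pi x y : x \in G -> y \in G ->
  (x * y).`_pi = x.`_pi * y.`_pi.
Proof. by move=> Gx Gy; apply/consttM/(centsP cGG). Qed.

(** The factors at [j <> i] are [r j]-elements with [r j <> r i], so their constituents at [r i] are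
    trivial. *)
Lemma constt_prod_primary (xi : I -> gT) i : (forall i, xi i \in H i) ->
  (\prod_i xi i).`_(r i) = xi i.
Proof.
move=> Hxi; have Gxi j : xi j \in G by apply: (subsetP (sHG j)).
transitivity (\prod_j (xi j).`_(r i)).
  elim: (index_enum I) => [|j s IHs]; first by rewrite !big_nil constt1.
  rewrite !big_cons consttM_abelian ?IHs //.
  by apply: group_prod => l _.
transitivity (\prod_(j | j == i) xi i); last by rewrite big_pred1_eq.
rewrite [RHS]big_mkcond; apply: eq_bigr => j _; case: eqP => [-> | /eqP ji].
  by apply: constt_p_elt; rewrite -mem_primary.
apply/constt1P; have := Hxi j; rewrite mem_primary //.
apply: sub_p_elt => p; rewrite !inE => /eqP->.
by apply: contra ji => /eqP/r_inj->.
Qed.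

(** A prime divisor of the order of [x^-1 * y] would be some [r i], but the constituent of this
    element at [r i] is trivial. *)
Lemma constt_primary_inj x y : x \in G -> y \in G ->
  (forall i, x.`_(r i) = y.`_(r i)) -> x = y.
Proof.
move=> Gx Gy eqxy; apply/eqP; rewrite eq_mulVg1; apply/eqP.
have [|gt1] := leqP #[x^-1 * y] 1.
  by rewrite leq_eqVlt ltnNge order_gt0 orbF order_eq1 => /eqP.
have p_pr := pdiv_prime gt1; have p_dv := pdiv_dvd #[x^-1 * y].
have Gz : x^-1 * y \in G by rewrite groupM ?groupV.
have [i def_p] := r_pi p_pr (dvdn_trans p_dv (order_dvdG Gz)).
have /constt1P : (x^-1 * y).`_(r i) = 1.
  by rewrite consttM_abelian ?groupV // consttV eqxy mulVg.
move/pnatP => /(_ (order_gt0 _) _ p_pr p_dv).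
by rewrite !inE def_p eqxx.
Qed.

(** Taking constituents is a bijection from [G] to the families of elements of the [H i], with
    inverse the product. *)
Lemma reindex_primary (R : Type) (idx : R) (op : Monoid.com_law idx)
    (F : {ffun I -> gT} -> R) :
  \big[op/idx]_(x in G) F [ffun i => x.`_(r i)]
  = \big[op/idx]_(xi in family H) F xi.
Proof.
rewrite (reindex_onto (fun x : gT => [ffun i => x.`_(r i)])
           (fun xi => \prod_i xi i)) => [|xi /familyP Hxi]; last first.
  by apply/ffunP=> i; rewrite ffunE constt_prod_primary.
apply: eq_bigl => x; apply/idP/andP=> [Gx | [/familyP Hx /eqP <-]]; last first.
  by apply: group_prod => i _; apply: (subsetP (sHG i)).
have Hx i : [ffun i => x.`_(r i)] i \in H i by rewrite ffunE constt_primary.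
split; first exact/familyP.
apply/eqP/constt_primary_inj => // [|i].
  by apply: group_prod => i _; apply: (subsetP (sHG i)).
by rewrite constt_prod_primary // ffunE.
Qed.

(** Writing an element of [H i] as [x^a * y^b] and taking constituents expresses it through those of
    [x] and [y]. Conversely, constituents are powers, and every element is the product of its
    own. *)
Lemma gen_primary x y : x \in G -> y \in G ->
  (<<[set x; y]>> == G) = [forall i, <<[set x.`_(r i); y.`_(r i)]>> == H i].
Proof.
move=> Gx Gy; have sxyG : <<[set x; y]>> \subset G.
  by rewrite gen_subG subUset !sub1set Gx.
have mem_gen2 (u v : gT) : u \in <<[set u; v]>> /\ v \in <<[set u; v]>>.
  by rewrite !mem_gen ?set21 ?set22.
apply/eqP/forallP=> [defG i | defH].
  have [Hx Hy] := (constt_primary i Gx, constt_primary i Gy).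
  rewrite eqEsubset gen_subG subUset !sub1set Hx Hy /=.
  apply/subsetP=> z Hz; have Gz := subsetP (sHG i) z Hz.
  have: z \in <[x]> * <[y]>.
    have cxy : <[y]> \subset 'C(<[x]>).
      by rewrite (sub_abelian_cent2 cGG) // cycle_subG.
    by rewrite -(cent_joinEr cxy) joing_idl joing_idr [_ <*> _]defG.
  case/mulsgP=> _ _ /cycleP[a ->] /cycleP[b ->] def_z.
  rewrite -(constt_p_elt (_ : (r i).-elt z)) -?mem_primary // def_z.
  rewrite consttM_abelian ?groupX // !consttX.
  by have [mx my] := mem_gen2 x.`_(r i) y.`_(r i); rewrite groupM // groupX.
apply/eqP; rewrite eqEsubset sxyG /=; apply/subsetP=> z Gz.
have -> : z = \prod_i z.`_(r i).
  apply: constt_primary_inj => // [|i].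
    by apply: group_prod => i _; rewrite groupX.
  by rewrite constt_prod_primary // => l; rewrite constt_primary.
apply: group_prod => i _; have := constt_primary i Gz.
rewrite -(eqP (defH i)); apply: subsetP.
have [mx my] := mem_gen2 x y.
by rewrite gen_subG subUset !sub1set !groupX.
Qed.

End Primary.

(* The spectral data of the Sylow subgroups are tensored: indices are tuples of
   local indices, bounded by [N] only to have a common type. *)
Lemma spectral_frame_primary (R : comNzRingType) (gT : finGroupType)
    (G : {group gT}) (I : finType) (r : I -> nat) (H : I -> {group gT})
    (N : nat) (m : I -> nat) (lam : I -> nat -> R)
    (e : I -> nat -> gT -> R) (f : I -> gT -> nat -> R) :
    abelian G -> injective r ->
    (forall p, prime p -> (p %| #|G|)%N -> exists i, p = r i) ->
    (forall i, ((r i).-Sylow(G) (H i))%g) -> (forall i, (m i <= N)%N) ->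
    (forall i, spectral_frame (H i) (m i) (lam i) (e i) (f i)) ->
  let P : pred {ffun I -> 'I_N} := fun phi => [forall i, (phi i < m i)%N] in
  let E (phi : {ffun I -> 'I_N}) x := \prod_i e i (phi i) (x.`_(r i))%g in
  let F x (phi : {ffun I -> 'I_N}) := \prod_i f i (x.`_(r i))%g (phi i) in
  (forall phi psi, P phi -> P psi ->
     \sum_(x in G) E phi x * F x psi = (phi == psi)%:R) /\
  (forall x y, x \in G -> y \in G ->
     (<<[set x; y]>>%g == G)%:R
     = \sum_(phi | P phi) F x phi * (\prod_i lam i (phi i)) * E phi y).
Proof.
move=> cGG r_inj r_pi sylH mN frame P E F.
have prodr_bool (b : pred I) : \prod_i (b i)%:R = [forall i, b i]%:R :> R.
  case: (boolP [forall i, b i]) => [/forallP b1 | /forallPn[i /negPf bi]].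
    by rewrite big1 // => i _; rewrite b1.
  by rewrite (bigD1 i) //= bi mul0r.
split=> [phi psi /forallP Pphi /forallP Ppsi | x y Gx Gy].
  pose h (xi : {ffun I -> gT}) :=
    \prod_i (e i (phi i) (xi i) * f i (xi i) (psi i)).
  transitivity (\sum_(x in G) h [ffun i => (x.`_(r i))%g]).
    apply: eq_bigr => x _; rewrite -big_split.
    by apply: eq_bigr => i _; rewrite !ffunE.
  (* Summing over all families of local elements turns the sum of products into a product of local
     sums. *)
  rewrite (reindex_primary cGG r_inj r_pi sylH).
  rewrite -(bigA_distr_big_dep _ (fun i z => e i (phi i) z * f i z (psi i))).
  rewrite (eq_bigr (fun i => (phi i == psi i)%:R)) => [|i _]; last first.
    by rewrite (frame i).1.
  rewrite prodr_bool; congr (nat_of_bool _)%:R.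
  apply/forallP/eqP=> [eqphi | -> //]; apply/ffunP=> i; exact/eqP.
rewrite (gen_primary cGG r_inj r_pi sylH) // -prodr_bool.
rewrite (eq_bigr (fun i => \sum_(a < N | (a < m i)%N)
   f i (x.`_(r i))%g a * lam i a * e i a (y.`_(r i))%g)) => [|i _]; last first.
  rewrite (frame i).2 ?(constt_primary cGG sylH) //.
  pose g a := f i (x.`_(r i))%g a * lam i a * e i a (y.`_(r i))%g.
  exact: (big_ord_widen _ g (mN i)).
rewrite bigA_distr_big_dep; apply: eq_big => [phi | phi _].
  by apply/familyP/forallP.
by rewrite !big_split.
Qed.

(** * Arithmetic and enumeration of the indices *)

Lemma multiplicative_prod (f : nat -> nat) (I : finType) (F : I -> nat) :
    f 1%N = 1%N ->
    (forall m n, (0 < m)%N -> (0 < n)%N -> coprime m n ->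
       f (m * n)%N = (f m * f n)%N) ->
    (forall i, (0 < F i)%N) -> (forall a b, a != b -> coprime (F a) (F b)) ->
  f (\prod_i F i)%N = (\prod_i f (F i))%N.
Proof.
move=> f1 fM F_gt0 coF; elim: (index_enum I) (index_enum_uniq I) => [|i s IHs].
  by rewrite !big_nil.
case/andP=> nis us; rewrite !big_cons fM ?IHs ?prodn_gt0 // big_seq.
apply: (big_ind (coprime (F i))) => [|m n ci cj|a sa]; first exact: coprimen1.
  by rewrite coprimeMr ci.
by apply: coF; apply: contraNneq nis => ->.
Qed.

(** A divisor of [m * n] is uniquely [a * b] with [a] dividing [m] and [b] dividing [n]; [a] is
    recovered as the gcd with [m]. *)
Lemma sigma_coprime m n : (0 < m)%N -> (0 < n)%N -> coprime m n ->
  sigma (m * n) = (sigma m * sigma n)%N.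
Proof.
move=> m_gt0 n_gt0 co_mn; rewrite /sigma big_distrlr /=.
transitivity (\sum_(d <- [seq a * b | a <- divisors m, b <- divisors n]) d)%N;
  last by rewrite big_allpairs_dep.
apply/perm_big/uniq_perm; rewrite ?divisors_uniq //.
  apply: allpairs_uniq; rewrite ?divisors_uniq // => x y.
  case/allpairsPdep=> a [b [/= Da Db ->]] /allpairsPdep[a' [b' [/= Da' Db' ->]]].
  rewrite -!dvdn_divisors // in Da Db Da' Db' * => /= eqab.
  have recl u v : (u %| m)%N -> (v %| n)%N -> gcdn m (u * v) = u.
    move=> um vn; rewrite Gauss_gcdl ?(coprime_dvdr vn) //.
    exact/gcdn_idPr.
  have eqa : a = a' by rewrite -(recl a b) // eqab recl.
  move: eqab; rewrite -eqa => /eqP; rewrite eqn_pmul2l ?(dvdn_gt0 _ Da) //.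
  by move/eqP->.
move=> d; rewrite -dvdn_divisors ?muln_gt0 ?m_gt0 //; apply/idP/allpairsPdep.
  move=> d_mn; exists (gcdn d m), (d %/ gcdn d m)%N.
  rewrite -!dvdn_divisors // dvdn_gcdr mulnC divnK ?dvdn_gcdl //; split=> //.
  have g_gt0 : (0 < gcdn d m)%N by rewrite gcdn_gt0 m_gt0 orbT.
  (* With [g = gcdn d m], the quotient [d / g] divides [(m / g) * n] and is coprime to [m / g]. *)
  rewrite -(@Gauss_dvdr _ (m %/ gcdn d m)).
    by rewrite -(dvdn_pmul2r g_gt0) mulnAC !divnK ?dvdn_gcdl ?dvdn_gcdr.
  rewrite /coprime -(eqn_pmul2r g_gt0) mul1n muln_gcdl.
  by rewrite !divnK ?dvdn_gcdl ?dvdn_gcdr // gcdnC.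
case=> a [b [/= + + ->]]; rewrite -!dvdn_divisors //; exact: dvdn_mul.
Qed.

Lemma sigma_prime p : prime p -> sigma p = p.+1.
Proof.
move=> p_pr; rewrite /sigma -[p.+1](_ : \sum_(d <- [:: 1; p]) d = _)%N; last first.
  by rewrite big_cons big_seq1.
apply/perm_big/uniq_perm; rewrite ?divisors_uniq //=.
  by rewrite inE neq_ltn prime_gt1.
move=> d; rewrite -dvdn_divisors ?prime_gt0 // !inE.
by apply/idP/orP=> [|[] /eqP-> //]; case/primeP: p_pr => _ /[apply] /orP.
Qed.

Lemma partn_prod_primes (I : finType) (r n : I -> nat) i :
    (forall i, prime (r i)) -> injective r ->
  ((\prod_x r x ^ n x)`_(r i) = r i ^ n i)%N.
Proof.
move=> r_pr r_inj; have gt0 x : (0 < r x ^ n x)%N by rewrite expn_gt0 prime_gt0.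
rewrite (bigD1 i) //= partnM ?prodn_gt0 // part_pnat_id ?pnatX ?pnat_id //.
rewrite part_p'nat ?muln1 //.
apply: (big_ind (fun m => (r i)^'.-nat m)) => // [m1 m2 | x xi].
  by move=> p1 p2; rewrite pnatM p1.
rewrite pnatX pnatE // !inE.
by apply/orP; left; apply: contra xi => /eqP/r_inj->.
Qed.

Lemma bigdprod_abelian (gT : finGroupType) (I : Type) (s : seq I)
    (S : I -> {group gT}) (K : {group gT}) :
    (forall i, abelian (S i)) ->
    (\big[dprod/1]_(i <- s) S i)%g = K :> {set gT} ->
  abelian K.
Proof.
move=> cSS; elim: s K => [|i s IHs] K.
  by rewrite big_nil => <-; apply: abelian1.
rewrite big_cons => /dprodP[[A B defA defB] <- cAB _].
by move: cAB; rewrite defB abelianM cSS (IHs _ defB).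
Qed.

Lemma sqrt_prod_nat (R : rcfType) (I : Type) (s : seq I) (F : I -> nat) :
  Num.sqrt (\prod_(i <- s) F i)%N%:R = \prod_(i <- s) Num.sqrt (F i)%:R :> R.
Proof.
elim: s => [|i s IHs]; first by rewrite !big_nil sqrtr1.
by rewrite !big_cons natrM sqrtrM ?ler0n // IHs.
Qed.

Lemma sum_ord_eq n v : (v < n)%N -> (\sum_(a < n | a == v :> nat) 1 = 1)%N.
Proof. by move=> ltvn; rewrite (big_pred1 (Ordinal ltvn)). Qed.

Lemma sum_ord_pos n p : (p < n)%N ->
  (\sum_(a < n | (0 < a) && (a < p.+1)) 1 = p)%N.
Proof.
move=> ltpn; rewrite -(big_ord_widen_cond _ (fun a => 0 < a)%N (fun=> 1%N)) //.
by rewrite big_mkcond big_ord_recl /= sum_nat_const card_ord muln1.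
Qed.

(** * Tuples of local indices, grouped by eigenvalue *)

Section Indices.
Variables (j k N : nat) (p : 'I_j -> nat).
Hypotheses (N_gt1 : (1 < N)%N) (ltpN : forall i, (p i < N)%N).

Definition index_bound (x : 'I_j + 'I_k) : nat :=
  if x is inl i then (p i).+1 else 2.

Definition valid_index (phi : {ffun 'I_j + 'I_k -> 'I_N}) : bool :=
  [forall x, (phi x < index_bound x)%N].

(* The local index at [p i] is [0] for the simple eigenvalue and positive for
   the [p i]-fold one; at [q b] it is the index of the root. *)
Definition index_key (phi : {ffun 'I_j + 'I_k -> 'I_N}) :
    {set 'I_j} * {ffun 'I_k -> 'I_2} :=
  ([set i | phi (inl i) == 0 :> nat]%N, [ffun b => inord (phi (inr (rev_ord b)))]).

(** Fixing the key constrains each coordinate separately: [0] at [i] in [E], one of [1, ..., p i] at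
    [i] outside [E], and a single root at each [q b]. The count is thus a product. *)
Lemma card_index_key El :
  (\sum_(phi : {ffun 'I_j + 'I_k -> 'I_N} |
       valid_index phi && (index_key phi == El)) 1
   = eig_mult p El.1)%N.
Proof.
case: El => E l /=.
pose Q (x : 'I_j + 'I_k) : pred 'I_N := match x with
  | inl i => fun a => if i \in E then a == 0 :> nat else (0 < a) && (a < (p i).+1)
  | inr b => fun a => a == l (rev_ord b) :> nat
  end%N.
transitivity (\sum_(phi in family Q) \prod_(x : 'I_j + 'I_k) 1)%N.
  apply: eq_big => [phi|]; last by move=> phi _; rewrite big1.
  apply/andP/familyP => [[/forallP lt_phi /eqP[defE defl]] [i|b] | Qphi].
  - rewrite unfold_in /= -defE inE; case: ifP => //.
    by rewrite lt0n => ->; apply: (lt_phi (inl i)).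
  - by rewrite unfold_in /= -defl ffunE rev_ordK inordK //.
  split; last first.
    apply/eqP; congr (_, _).
      apply/setP=> i; rewrite inE.
      have /= : Q (inl i) (phi (inl i)) := Qphi (inl i).
      by case: ifP => // _ /andP[]; rewrite lt0n => /negPf.
    apply/ffunP=> b; have /= : Q (inr _) (phi (inr _)) := Qphi (inr (rev_ord b)).
    by rewrite rev_ordK ffunE => /eqP->; rewrite inord_val.
  apply/forallP=> -[i|b].
    have /= : Q (inl i) (phi (inl i)) := Qphi (inl i).
    case: ifP => _ => [/eqP-> // | /andP[] //].
  by have /= : Q (inr _) (phi (inr _)) := Qphi (inr b); move=> /eqP->.
rewrite -(bigA_distr_big_dep _ (fun _ _ => 1%N)) big_sumType /=.
rewrite [X in (_ * X)%N]big1 ?muln1 => [|b _]; last first.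
  by rewrite sum_ord_eq // (leq_trans (ltn_ord _) N_gt1).
rewrite /eig_mult [RHS]big_mkcond; apply: eq_bigr => i _; rewrite inE.
by case: (i \in E); rewrite /= ?sum_ord_eq ?sum_ord_pos // ltnW.
Qed.

(** The operation is arbitrary so that one regrouping yields both the product of linear factors and
    the number of indices. *)
Lemma big_index_key (R : Type) (idx : R) (op : Monoid.com_law idx) (V : Type)
    (v : {ffun 'I_j + 'I_k -> 'I_N} -> V)
    (eig : {set 'I_j} -> {ffun 'I_k -> 'I_2} -> V) (g : V -> R) :
    (forall phi, valid_index phi ->
       v phi = eig (index_key phi).1 (index_key phi).2) ->
  \big[op/idx]_(phi | valid_index phi) g (v phi)
  = \big[op/idx]_(y <- flatten [seq nseq (eig_mult p El.1) (eig El.1 El.2)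
                           | El : {set 'I_j} * {ffun 'I_k -> 'I_2}]) g y.
Proof.
move=> vE; rewrite big_flatten big_map big_enum /=.
rewrite (partition_big index_key predT) //=; apply: eq_bigr => El _.
rewrite (eq_bigr (fun=> g (eig El.1 El.2))); last first.
  by move=> phi /andP[/vE-> /eqP->].
by rewrite big_nseq -card_index_key big_const sum1_card.
Qed.

End Indices.

(** Expanding [\prod_i (1 + p i)], which is [sigma] of the product, over subsets gives the
    multiplicities; the root choices contribute [2 ^ k]. *)
Lemma sum_eig_mult j k (p : 'I_j -> nat) : (forall i, prime (p i)) ->
    injective p ->
  (\sum_(El : {set 'I_j} * {ffun 'I_k -> 'I_2}) eig_mult p El.1
   = 2 ^ k * sigma (\prod_i p i))%N.
Proof.
move=> p_pr p_inj; rewrite multiplicative_prod //.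
- rewrite (eq_bigr (fun i => 1 + p i)%N) => [|i _]; last by rewrite sigma_prime.
  rewrite bigA_distr -(pair_big predT predT
    (fun E (_ : {ffun 'I_k -> 'I_2}) => eig_mult p E)) /=.
  rewrite big_distrr; apply: eq_bigr => E _.
  rewrite sum_nat_const card_ffun !card_ord; congr (_ * _)%N.
  rewrite /eig_mult big_mkcond; apply: eq_bigr => i _; rewrite inE.
  by case: (i \in E).
- by rewrite /sigma big_seq1.
- exact: sigma_coprime.
- by move=> i; apply: prime_gt0.
by move=> a b neq; rewrite prime_coprime // dvdn_prime2 // (inj_eq p_inj).
Qed.

(** * Eigenvalues of the generating graph *)

Lemma prod_expn_div (I : finType) (r n : I -> nat) :
    (forall i, prime (r i)) -> (forall i, (0 < n i)%N) ->
  (\prod_i r i ^ n i = \prod_i r i * \prod_i (r i ^ n i %/ r i))%N.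
Proof.
move=> r_pr n_gt0; rewrite -big_split; apply: eq_bigr => i _ /=.
by rewrite mulnC divnK // dvdn_exp.
Qed.

Lemma totient_prod (I : finType) (r n : I -> nat) :
    (forall i, prime (r i)) -> injective r ->
  totient (\prod_i r i ^ n i) = (\prod_i totient (r i ^ n i))%N.
Proof.
move=> r_pr r_inj; apply: multiplicative_prod => //.
- by move=> m m' _ _; apply: totient_coprime.
- by move=> i; rewrite expn_gt0 prime_gt0.
move=> a b neq; rewrite coprimeXl // coprimeXr //.
by rewrite prime_coprime // dvdn_prime2 // (inj_eq r_inj).
Qed.

(** Every factor of the closed formula splits over the primes, which identifies it with a product of
    local eigenvalues. *)
Lemma eig_val_prod (R : rcfType) (j k : nat) (p u : 'I_j -> nat)
    (q t : 'I_k -> nat) (E : {set 'I_j}) (l : {ffun 'I_k -> 'I_2}) :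
    (forall i, prime (p i)) -> (forall b, prime (q b)) ->
    injective p -> injective q ->
    (forall i, (0 < u i)%N) -> (forall b, (0 < t b)%N) ->
  eig_val R p q (\prod_(b < k) q b ^ t b)%N (\prod_(b < k) q b)%N
    (\prod_(i < j) p i ^ u i)%N (\prod_(i < j) p i)%N E l
  = \prod_i (let c := (totient (p i ^ u i %/ p i))%:R in
             if i \in E then c * (p i)%:R else - c)
    * \prod_b ((q b ^ t b %/ q b)%:R * u_scaled R (q b) (l (rev_ord b))).
Proof.
move=> p_pr q_pr p_inj q_inj u_gt0 t_gt0; rewrite /eig_val.
have q0 : (\prod_(b < k) q b)%N%:R != 0 :> R.
  by rewrite pnatr_eq0 -lt0n prodn_gt0 // => b; apply: prime_gt0.
rewrite (prod_expn_div q_pr t_gt0) (prod_expn_div p_pr u_gt0).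
rewrite mulKn ?prodn_gt0 // => [|i]; last exact: prime_gt0.
rewrite [(_ * _)%N%:R]natrM [_ / _]mulrAC divff // mul1r.
have -> : (totient (\prod_(i < j) (p i ^ u i %/ p i)) =
           \prod_(i < j) totient (p i ^ u i %/ p i))%N.
  have divp i : (p i ^ u i %/ p i = p i ^ (u i).-1)%N.
    by rewrite -{1}(prednK (u_gt0 i)) expnS mulKn ?prime_gt0.
  rewrite (eq_bigr _ (fun i _ => divp i)) totient_prod //.
  by apply: eq_bigr => i _; rewrite divp.
have -> : (totient (\prod_(b < k) q b) = \prod_(b < k) totient (q b))%N.
  transitivity (totient (\prod_(b < k) q b ^ 1)).
    by congr totient; apply: eq_bigr => b _; rewrite expn1.
  rewrite (totient_prod (fun=> 1%N) q_pr q_inj).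
  by apply: eq_bigr => b _; rewrite expn1.
rewrite sqrt_prod_nat !natr_prod.
(* Reversing the order of the factors moves [rev_ord] from the primes to the root choices. *)
have -> : \prod_(b < k) u_root R (q (rev_ord b)) (l b)
          = \prod_(b < k) u_root R (q b) (l (rev_ord b)).
  rewrite (reindex_inj rev_ord_inj).
  by apply: eq_bigr => b _; rewrite rev_ordK.
have -> : \prod_b ((q b ^ t b %/ q b)%:R * u_scaled R (q b) (l (rev_ord b)))
   = \prod_b (q b ^ t b %/ q b)%:R * \prod_b Num.sqrt (totient (q b))%:R
     * \prod_b u_root R (q b) (l (rev_ord b)) :> R.
  rewrite -!big_split; apply: eq_bigr => b _.
  by rewrite /u_scaled inord_val /= mulrA.
have -> : \prod_i (let c := (totient (p i ^ u i %/ p i))%:R in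
             if i \in E then c * (p i)%:R else - c)
   = \prod_i (totient (p i ^ u i %/ p i))%:R
     * ((-1) ^+ #|~: E| * \prod_(i in E) (p i)%:R) :> R.
  (* The sign is spread as one factor [-1] for each [i] outside [E]. *)
  have -> : (-1) ^+ #|~: E| * \prod_(i in E) (p i)%:R
            = \prod_i (if i \in E then (p i)%:R else -1) :> R.
    rewrite [RHS](bigID (mem E)) /= mulrC -prodr_const; congr (_ * _).
      by apply: eq_bigr => i ->.
    by apply: eq_big => [i | i]; rewrite inE // => /negPf->.
  rewrite -big_split.
  by apply: eq_bigr => i _ /=; case: (i \in E); rewrite ?mulrN1.
ring.
Qed.

Lemma eig_val_neq0 (R : rcfType) (j k : nat) (p u : 'I_j -> nat)
    (q t : 'I_k -> nat) (E : {set 'I_j}) (l : {ffun 'I_k -> 'I_2}) :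
    (forall i, prime (p i)) -> (forall b, prime (q b)) ->
    injective p -> injective q ->
    (forall i, (0 < u i)%N) -> (forall b, (0 < t b)%N) ->
  eig_val R p q (\prod_(b < k) q b ^ t b)%N (\prod_(b < k) q b)%N
    (\prod_(i < j) p i ^ u i)%N (\prod_(i < j) p i)%N E l != 0.
Proof.
move=> p_pr q_pr p_inj q_inj u_gt0 t_gt0; rewrite eig_val_prod //.
have div_gt0 r n : prime r -> (0 < n)%N -> (0 < r ^ n %/ r)%N.
  move=> r_pr n_gt0; have r_gt0 := prime_gt0 r_pr; rewrite divn_gt0 //.
  by apply: dvdn_leq; rewrite ?expn_gt0 ?r_gt0 ?dvdn_exp.
apply: mulf_neq0.
  apply/prodf_neq0 => i _.
  have c0 : (totient (p i ^ u i %/ p i))%:R != 0 :> R.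
    by rewrite pnatr_eq0 -lt0n totient_gt0 div_gt0.
  move=> /=; case: ifP => _; last by rewrite oppr_eq0.
  by rewrite mulf_neq0 // pnatr_eq0 -lt0n prime_gt0.
apply/prodf_neq0 => b _.
rewrite mulf_neq0 //; first by rewrite pnatr_eq0 -lt0n div_gt0.
(* The two roots have product [- totient (q b)], so neither vanishes. *)
have [_ muM _] := u_scaled_roots R (q_pr b).
have : u_scaled R (q b) 0%N * u_scaled R (q b) 1%N != 0.
  by rewrite muM oppr_eq0 pnatr_eq0 -lt0n totient_gt0 prime_gt0.
rewrite mulf_eq0 negb_or => /andP[mu0 mu1].
by case: (l _) => -[|[|m]] //=.
Qed.

Theorem theorem6p3 (R : rcfType) (j k : nat) (hj : (1 <= j)%N) (hk : (1 <= k)%N)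
    (p u : 'I_j -> nat) (q t : 'I_k -> nat)
    (p_prime : forall i, prime (p i)) (q_prime : forall b, prime (q b))
    (p_inj : injective p)
    (q_incr : forall a b : 'I_k, (a < b)%N -> (q a < q b)%N)
    (p_neq_q : forall i b, p i <> q b)
    (t_pos : forall b, (1 <= t b)%N)
    (s s0 sbar sbar0 : nat)
    (def_s : s = (\prod_(b < k) q b ^ t b)%N)
    (def_s0 : s0 = (\prod_(b < k) q b)%N)
    (def_sbar : sbar = (\prod_(i < j) p i ^ u i)%N)
    (def_sbar0 : sbar0 = (\prod_(i < j) p i)%N)
    (gT : finGroupType) (G : {group gT}) (S : 'I_j -> {group gT})
    (C : {group gT})
    (S_abelian : forall i, abelian (S i))
    (S_noncyclic : forall i, ~~ cyclic (S i))
    (S_card : forall i, #|S i| = (p i ^ u i)%N)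
    (C_cyclic : cyclic C) (C_card : #|C| = s)
    (def_G : ((\big[dprod/1]_(i < j) S i) \x C)%g = G)
    (G_rank : ('m(G))%g = 2%N) :
  exists sp : seq R,
    [/\ is_spectrum (gen_graph_mx R G) sp,
        perm_eq [seq x <- sp | x != 0]
          (flatten [seq nseq (eig_mult p El.1)
                          (eig_val R p q s s0 sbar sbar0 El.1 El.2)
                   | El : {set 'I_j} * {ffun 'I_k -> 'I_2}])
      & count_mem 0 sp = (#|G| - 2 ^ k * sigma sbar0)%N].

Proof.
have q_inj : injective q.
  move=> a b eq_ab; apply/val_inj.
  by case: (ltngtP a b) => // /q_incr; rewrite eq_ab ltnn.
subst s s0 sbar sbar0.
have [[Sb _ defSb _] defG cSC _] := dprodP def_G.
rewrite defSb in defG cSC.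
have sSG i : S i \subset G.
  rewrite -defG; apply: subset_trans (mulG_subl _ _).
  by rewrite -(bigdprodWY defSb) sub_gen // (bigcup_sup i).
have sCG : C \subset G by rewrite -defG mulG_subr.
have cGG : abelian G.
  rewrite -defG abelianM (cyclic_abelian C_cyclic) cSC.
  by rewrite (bigdprod_abelian S_abelian defSb).
pose r (x : 'I_j + 'I_k) := match x with inl i => p i | inr b => q b end.
pose n (x : 'I_j + 'I_k) := match x with inl i => u i | inr b => t b end.
have r_pr x : prime (r x) by case: x.
have r_inj : injective r.
  move=> [i|b] [i'|b'] //= => [/p_inj-> // | /p_neq_q // | /esym/p_neq_q // | /q_inj-> //].
have cardG : #|G| = (\prod_x r x ^ n x)%N.
  rewrite -(dprod_card def_G) C_card defSb -(bigdprod_card defSb) big_sumType /=.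
  by congr (_ * _)%N; apply: eq_bigr => i _; rewrite S_card.
(* Exponent [0] would make [S i] trivial, hence cyclic. *)
have u_gt0 i : (0 < u i)%N.
  rewrite lt0n; apply: contra (S_noncyclic i) => /eqP u0.
  by rewrite (card1_trivg (_ : #|S i| = 1%N)) ?cyclic1 // S_card u0.
pose H (x : 'I_j + 'I_k) : {group gT} :=
  match x with inl i => S i | inr b => 'O_(q b)(C)%G end.
have cardH x : #|H x| = (r x ^ n x)%N.
  case: x => [i|b] /=; first exact: S_card.
  rewrite (card_Hall (nilpotent_pcore_Hall _ (abelian_nil (cyclic_abelian C_cyclic)))).
  by rewrite C_card partn_prod_primes.
have sylH x : ((r x).-Sylow(G) (H x))%g.
  rewrite pHallE cardH cardG partn_prod_primes // eqxx andbT.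
  by case: x => [i|b] /=; rewrite ?sSG // (subset_trans (pcore_sub _ _)).
have r_pi P : prime P -> (P %| #|G|)%N -> exists x, P = r x.
  move=> P_pr; rewrite cardG Euclid_dvd_prod // big_has => /hasP[x _].
  by rewrite Euclid_dvdX // dvdn_prime2 // => /andP[/eqP-> _]; exists x.
have rS i : ('m(S i)%g <= 2)%N.
  by rewrite grank_abelian // -G_rank (grank_abelian cGG) rankS.
pose lam (x : 'I_j + 'I_k) (a : nat) : R := match x with
  | inl i => let c := (totient (#|H (inl i)| %/ p i))%:R in
             if a == 0%N then c * (p i)%:R else - c
  | inr b => (#|H (inr b)| %/ q b)%:R * u_scaled R (q b) a
  end.
pose m (x : 'I_j + 'I_k) := index_bound p x.
have frames x : exists ef : (nat -> gT -> R) * (gT -> nat -> R),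
    spectral_frame (H x) (m x) (lam x) ef.1 ef.2.
  case: x => [i|b].
    have [|e [f ef]] := rank2_spectral_frame (p_prime i) _ (S_abelian i)
                          (S_noncyclic i) (rS i) R.
      by rewrite /pgroup S_card pnatX pnat_id ?p_prime.
    by exists (e, f).
  have [|e [f ef]] := cyclic_spectral_frame R (q_prime b) _ (t_pos b) (cardH (inr b)).
    exact: cyclicS (pcore_sub _ _) C_cyclic.
  by exists (e, f).
have [ef frame] := fin_all_exists frames.
(* A common bound for the local indices: it exceeds every [p i], and is at least [2] for the cyclic
   factors. *)
pose N := (\sum_i p i).+2.
have ltpN i : (p i < N)%N by rewrite ltnS (bigD1 i) //= leqW ?leq_addr.
have lemN x : (m x <= N)%N by case: x => [i|b]; rewrite /m /= ?ltpN.
have [orth rec] := spectral_frame_primary cGG r_inj r_pi sylH lemN frame.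
pose v (phi : {ffun 'I_j + 'I_k -> 'I_N}) := \prod_x lam x (phi x).
pose E (phi : {ffun 'I_j + 'I_k -> 'I_N}) x := \prod_i (ef i).1 (phi i) (x.`_(r i))%g.
pose F x (phi : {ffun 'I_j + 'I_k -> 'I_N}) := \prod_i (ef i).2 (x.`_(r i))%g (phi i).
have [||leG charG] := @char_poly_biorthogonal R #|G| _ (valid_index p) v
   (fun x phi => F (enum_val x) phi) (fun phi x => E phi (enum_val x))
   (gen_graph_mx R G).
- by move=> phi psi /orth /[apply] <-; rewrite [RHS]big_enum_val.
- move=> x y; rewrite mxE -rec ?enum_valP // /gen_graph.
  (* The graph has no loops while the decomposed relation allows [x = y]; they agree since no single
     element generates [G], which contains a non-cyclic subgroup because [j] is positive. *)
  case: eqVneq => [-> | //].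
  suff /negPf -> : <<[set enum_val y; enum_val y]>>%g != G by [].
  apply/eqP; move: (enum_val y) => z defG'.
  have /negP[] := S_noncyclic (Ordinal hj).
  apply: cyclicS (sSG _) _; apply/cyclicP; exists z.
  by rewrite -defG' setUid.
pose L := flatten [seq nseq (eig_mult p El.1) (eig_val R p q
   (\prod_(b < k) q b ^ t b)%N (\prod_(b < k) q b)%N
   (\prod_(i < j) p i ^ u i)%N (\prod_(i < j) p i)%N El.1 El.2)
   | El : {set 'I_j} * {ffun 'I_k -> 'I_2}].
have vE phi : valid_index p phi -> v phi = eig_val R p q
   (\prod_(b < k) q b ^ t b)%N (\prod_(b < k) q b)%N
   (\prod_(i < j) p i ^ u i)%N (\prod_(i < j) p i)%N
   (index_key phi).1 (index_key phi).2.
  move=> /forallP lt_phi; rewrite eig_val_prod // /v big_sumType /=.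
  congr (_ * _).
    by apply: eq_bigr => i _; rewrite inE S_card.
  apply: eq_bigr => b _; rewrite ffunE rev_ordK inordK; last exact: lt_phi (inr b).
  by rewrite (cardH (inr b)).
have bigL (T : Type) (idx : T) (op : Monoid.com_law idx) (g : R -> T) :
  \big[op/idx]_(phi | valid_index p phi) g (v phi) = \big[op/idx]_(y <- L) g y.
  by apply: big_index_key => // i; rewrite ltpN.
have sizeL : size L = (2 ^ k * sigma (\prod_i p i))%N.
  rewrite -(sum_eig_mult k p_prime p_inj) size_flatten /shape -map_comp sumnE.
  by rewrite big_map big_enum; apply: eq_bigr => El _; rewrite /= size_nseq.
have cardL : #|(valid_index p : pred {ffun 'I_j + 'I_k -> 'I_N})| = size L.
  by rewrite -[RHS]sum1_size -(bigL _ _ addn (fun=> 1%N)) -sum1_card.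
have L0 : all (fun y => y != 0) L.
  apply/allP=> y /flattenP[_ /mapP[El _ ->]] /nseqP[-> _].
  exact: eig_val_neq0.
(* The zeros appended to the non-zero eigenvalues match the power of ['X] in [charG]. *)
exists (L ++ nseq (#|G| - size L) 0); split.
- rewrite /is_spectrum charG cardL (bigL _ _ _ (fun y => 'X - y%:P)) big_cat /=.
  by rewrite mulrC big_nseq subr0 iter_mulr_1.
- by rewrite filter_cat (all_filterP L0) filter_nseq eqxx cats0.
rewrite count_cat count_nseq /= eqxx mul1n sizeL.
by rewrite (count_memPn _) //; apply/negP=> /(allP L0); rewrite eqxx.
Qed.
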